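(* Let $A$ and $B$ be finite dimensional symmetric algebras over a field $k$. Then $A$ and $B$ are separably equivalent if and only if $A$ and $B$ are symmetrically separably equivalent.
   Context: A finite dimensional $k$-algebra $A$ is symmetric if $A\cong\operatorname{Hom}_k(A,k)$ as $A$-$A$-bimodules. Modules are right modules; $k$ acts centrally on all bimodules. $A$ and $B$ are separably equivalent if there are bimodules ${}_AM_B$ and ${}_BN_A$, each finitely generated and projective as a left module and as a right module, together with bimodules ${}_AX_A$, ${}_BY_B$ and bimodule isomorphisms $M\otimes_B N\cong A\oplus X$ and $N\otimes_A M\cong B\oplus Y$; the pair $(M,N)$ is then called a separable equivalence. $A$ and $B$ are symmetrically separably equivalent if there is a separable equivalence $(M,N)$ such that the functor $-\otimes_A M$ (from $A$-modules to $B$-modules) is both left and right adjoint to the functor $-\otimes_B N$ (from $B$-modules to $A$-modules). *)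

(* Defs.v *)
From HB Require Import structures.
From mathcomp Require Import all_boot all_algebra.
From mathcomp Require Import boolp functions freeg.

Set Implicit Arguments.
Unset Strict Implicit.
Unset Printing Implicit Defensive.

Import GRing.Theory.
Local Open Scope ring_scope.
Local Open Scope quotient_scope.

(* A finite dimensional k-algebra is a ring A with a ring morphism from k to
   the centre of A, spanned over k by finitely many elements.  The library's
   falgType is not used because it excludes the zero algebra. *)

HB.mixin Record isFdAlgebra (k : fieldType) A of GRing.PzRing A := {
  inalg : {rmorphism k -> A};
  inalg_central : forall (c : k) (x : A), inalg c * x = x * inalg c;
  fdalg_finite_dim : exists n (e : 'I_n -> A), forall x, exists c : 'I_n -> k,
    x = \sum_(i < n) inalg (c i) * e i
}.

#[short(type="fdAlgType")]
HB.structure Definition FdAlgebra (k : fieldType) :=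
  {A of GRing.PzRing A & isFdAlgebra k A}.

(* A left R-module is an lmodType R; a right R-module is a left module over
   the converse ring R^c, the right action of a on x being x *:> a. *)

Notation rmodType R := (lmodType R^c).
Notation "x *:> a" := (@GRing.scale (GRing.converse _) _ a x)
  (at level 40, left associativity) : ring_scope.

Definition fin_gen (R : pzRingType) (P : lmodType R) : Prop :=
  exists n (e : 'I_n -> P), forall x, exists a : 'I_n -> R,
    x = \sum_(i < n) a i *: e i.

Definition projective (R : pzRingType) (P : lmodType R) : Prop :=
  forall (X Y : lmodType R) (g : {linear X -> Y}) (f : {linear P -> Y}),
    (forall y, exists x, g x = y) ->
    exists h : {linear P -> X}, forall p, g (h p) = f p.

HB.mixin Record Lmodule_isBimodule (k : fieldType) (A B : fdAlgType k) M
    of GRing.Lmodule A M := {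
  ract : M -> B -> M;
  ractA : forall m b b', ract (ract m b) b' = ract m (b * b');
  ract1 : forall m, ract m 1 = m;
  ractDl : forall b, {morph ract^~ b : m n / m + n};
  ractDr : forall m, {morph ract m : b b' / b + b'};
  ractZ : forall (a : A) m b, ract (a *: m) b = a *: ract m b;
  ract_central : forall (c : k) m, ract m (inalg c) = (inalg c : A) *: m
}.

#[short(type="bimodType")]
HB.structure Definition Bimodule (k : fieldType) (A B : fdAlgType k) :=
  {M of GRing.Lmodule A M & Lmodule_isBimodule k A B M}.

(* The right module underlying a bimodule; the left one is the bimodule itself
   seen as an lmodType. *)
Definition rside (k : fieldType) (A B : fdAlgType k) (M : bimodType A B) : Type
  := M.

Section RightModule.
Context (k : fieldType) (A B : fdAlgType k) (M : bimodType A B).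

HB.instance Definition _ := GRing.Zmodule.on (rside M).

Fact rside_scaleA (b b' : B^c) (m : rside M) :
  ract (ract (m : M) (b' : B)) (b : B) = ract (m : M) (b * b' : B^c).
Proof. exact: ractA. Qed.

Fact rside_scaleDl (m : rside M) :
  {morph (fun b : B^c => ract (m : M) (b : B) : rside M) : b b' / b + b'}.
Proof. exact: ractDr. Qed.

HB.instance Definition _ :=
  GRing.Zmodule_isLmodule.Build (B^c) (rside M)
    rside_scaleA (@ract1 _ _ _ M) (@ractDl _ _ _ M) rside_scaleDl.
End RightModule.

Definition bimod_iso (k : fieldType) (A B : fdAlgType k)
    (M N : bimodType A B) : Prop :=
  exists f : {linear M -> N},
    bijective f /\ forall m b, f (ract m b) = ract (f m) b.

Section Regular.
Context (k : fieldType) (A : fdAlgType k).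

Definition regbimod_ract (x : A^o) (a : A) : A^o := (x : A) * a.

Fact regbimod_ractA x a b :
  regbimod_ract (regbimod_ract x a) b = regbimod_ract x (a * b).
Proof. by rewrite /regbimod_ract mulrA. Qed.
Fact regbimod_ractDl a : {morph regbimod_ract^~ a : x y / x + y}.
Proof. by move=> x y; rewrite /regbimod_ract mulrDl. Qed.
Fact regbimod_ractZ (a : A) x b :
  regbimod_ract (a *: x) b = a *: regbimod_ract x b.
Proof. by rewrite /regbimod_ract [RHS]mulrA. Qed.
Fact regbimod_ract_central (c : k) x :
  regbimod_ract x (inalg c) = (inalg c : A) *: x.
Proof. by rewrite /regbimod_ract -inalg_central. Qed.

HB.instance Definition _ := Lmodule_isBimodule.Build k A A A^o
  regbimod_ractA (@mulr1 A) regbimod_ractDl (@mulrDr A)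
  regbimod_ractZ regbimod_ract_central.
End Regular.

Section DirectSum.
Context (k : fieldType) (A B : fdAlgType k) (M N : bimodType A B).

Definition dsum_ract (m : M * N) (b : B) : M * N := (ract m.1 b, ract m.2 b).

Fact dsum_ractA m b b' :
  dsum_ract (dsum_ract m b) b' = dsum_ract m (b * b').
Proof. by rewrite /dsum_ract !ractA. Qed.
Fact dsum_ract1 m : dsum_ract m 1 = m.
Proof. by case: m => x y; rewrite /dsum_ract !ract1. Qed.
Fact dsum_ractDl b : {morph dsum_ract^~ b : m n / m + n}.
Proof. by move=> m n; congr pair; rewrite /= ractDl. Qed.
Fact dsum_ractDr m : {morph dsum_ract m : b b' / b + b'}.
Proof. by move=> b b'; congr pair; rewrite /= ractDr. Qed.
Fact dsum_ractZ (a : A) m b : dsum_ract (a *: m) b = a *: dsum_ract m b.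
Proof. by congr pair; rewrite /= ractZ. Qed.
Fact dsum_ract_central (c : k) m :
  dsum_ract m (inalg c) = (inalg c : A) *: m.
Proof. by congr pair; rewrite /= ract_central. Qed.

HB.instance Definition _ := Lmodule_isBimodule.Build k A B (M * N)%type
  dsum_ractA dsum_ract1 dsum_ractDl dsum_ractDr dsum_ractZ dsum_ract_central.
End DirectSum.

(* The bimodule Hom_k(A, k), with (a f b)(x) = f (b x a) *)
Section Dual.
Context (k : fieldType) (A : fdAlgType k).

Definition klinear (f : A -> k^o) : Prop :=
  (forall x y, f (x + y) = f x + f y) /\
  (forall (c : k) x, f (inalg c * x) = c * f x).

Definition klinear_pred : {pred A -> k^o} := fun f => `[< klinear f >].

Fact klinear_zmod_closed : zmod_closed klinear_pred.
Proof.
split=> [|f g /asboolP[fD fZ] /asboolP[gD gZ]]; apply/asboolP; split.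
- by move=> x y; exact: esym (addr0 _).
- by move=> c x; exact: esym (mulr0 _).
- by move=> x y; apply: etrans (congr2 _ (fD x y) (congr1 _ (gD x y))) _;
    rewrite opprD addrACA.
- by move=> c x; apply: etrans (congr2 _ (fZ c x) (congr1 _ (gZ c x))) _;
    rewrite -mulrBr.
Qed.

HB.instance Definition _ :=
  GRing.isZmodClosed.Build (A -> k^o) klinear_pred klinear_zmod_closed.

Record dual := Dual {dual_fun :> A -> k^o; _ : dual_fun \in klinear_pred}.
HB.instance Definition _ := [isSub for dual_fun].
HB.instance Definition _ := [Choice of dual by <:].
HB.instance Definition _ := [SubChoice_isSubZmodule of dual by <:].

Lemma dual_ext (f g : dual) : f =1 g -> f = g.
Proof. by move=> fg; apply/val_inj/funext. Qed.

Lemma dualD (f : dual) x y : f (x + y) = f x + f y.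
Proof. by case: f => f /= /asboolP[]. Qed.

Lemma dualZ (f : dual) (c : k) x : f (inalg c * x) = c * f x.
Proof. by case: f => f /= /asboolP[]. Qed.

Lemma addfE (f g : dual) x : (f + g) x = f x + g x.
Proof. by []. Qed.

Fact dual_lact_subproof a (f : dual) :
  (fun x => f (x * a)) \in klinear_pred.
Proof.
apply/asboolP; split=> [x y|c x]; first by rewrite mulrDl dualD.
by rewrite -mulrA dualZ.
Qed.
Definition dual_lact a f : dual := Dual (dual_lact_subproof a f).

Fact dual_ract_subproof (f : dual) b :
  (fun x => f (b * x)) \in klinear_pred.
Proof.
apply/asboolP; split=> [x y|c x]; first by rewrite mulrDr dualD.
by rewrite mulrA -inalg_central -mulrA dualZ.
Qed.
Definition dual_ract f b : dual := Dual (dual_ract_subproof f b).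

Fact dual_lactA a b f : dual_lact a (dual_lact b f) = dual_lact (a * b) f.
Proof. by apply: dual_ext => x /=; rewrite mulrA. Qed.
Fact dual_lact1 : left_id 1 dual_lact.
Proof. by move=> f; apply: dual_ext => x /=; rewrite mulr1. Qed.
Fact dual_lactDr : right_distributive dual_lact +%R.
Proof. by move=> a f g; apply: dual_ext. Qed.
Fact dual_lactDl f : {morph dual_lact^~ f : a b / a + b}.
Proof. by move=> a b; apply: dual_ext => x /=; rewrite mulrDr dualD. Qed.

HB.instance Definition _ := GRing.Zmodule_isLmodule.Build A dual
  dual_lactA dual_lact1 dual_lactDr dual_lactDl.

Fact dual_ractA f b b' : dual_ract (dual_ract f b) b' = dual_ract f (b * b').
Proof. by apply: dual_ext => x /=; rewrite mulrA. Qed.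
Fact dual_ract1 f : dual_ract f 1 = f.
Proof. by apply: dual_ext => x /=; rewrite mul1r. Qed.
Fact dual_ractDl b : {morph dual_ract^~ b : f g / f + g}.
Proof. by move=> f g; apply: dual_ext. Qed.
Fact dual_ractDr f : {morph dual_ract f : b b' / b + b'}.
Proof. by move=> b b'; apply: dual_ext => x /=; rewrite mulrDl dualD. Qed.
Fact dual_ractZ (a : A) f b : dual_ract (a *: f) b = a *: dual_ract f b.
Proof. by apply: dual_ext => x /=; rewrite mulrA. Qed.
Fact dual_ract_central (c : k) f :
  dual_ract f (inalg c) = (inalg c : A) *: f.
Proof. by apply: dual_ext => x /=; rewrite inalg_central. Qed.

HB.instance Definition _ := Lmodule_isBimodule.Build k A A dual
  dual_ractA dual_ract1 dual_ractDl dual_ractDr dual_ractZ dual_ract_central.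
End Dual.
Arguments dual {k} A.

Definition symmetric_algebra (k : fieldType) (A : fdAlgType k) : Prop :=
  bimod_iso A^o (dual A).

(* The tensor product over R of a right module and a left module: the free
   abelian group on X * Y modulo the subgroup generated by the bilinearity and
   balancing relations. *)
Section Tensor.
Context (R : pzRingType) (X : rmodType R) (Y : lmodType R).

Inductive tens_rel : {freeg (X * Y)%type / int} -> Prop :=
| TensRel0 : tens_rel 0
| TensRelB u v : tens_rel u -> tens_rel v -> tens_rel (u - v)
| TensRelDl x x' y : tens_rel (<< (x + x', y) >> - (<< (x, y) >> + << (x', y) >>))
| TensRelDr x y y' : tens_rel (<< (x, y + y') >> - (<< (x, y) >> + << (x, y') >>))
| TensRelA x (a : R) y : tens_rel (<< (x *:> a, y) >> - << (x, a *: y) >>).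

Definition tens_ker : {pred {freeg (X * Y)%type / int}} := fun u => `[< tens_rel u >].

Fact tens_ker_zmod_closed : zmod_closed tens_ker.
Proof.
split=> [|u v /asboolP ru /asboolP rv]; apply/asboolP; first exact: TensRel0.
exact: TensRelB.
Qed.

HB.instance Definition _ :=
  GRing.isZmodClosed.Build _ tens_ker tens_ker_zmod_closed.

Definition tens : Type := Quotient.quot tens_ker.
HB.instance Definition _ := GRing.Zmodule.on tens.

Definition tensor (x : X) (y : Y) : tens :=
  \pi_(Quotient.quot tens_ker) << (x, y) >>.

Lemma tensorE x y : tensor x y = \pi_(Quotient.quot tens_ker) << (x, y) >>.
Proof. by []. Qed.

Lemma tens_rel_eq u v : tens_rel (u - v) ->
  \pi_(Quotient.quot tens_ker) u = \pi_(Quotient.quot tens_ker) v.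
Proof.
by move=> ruv; apply/eqP; rewrite -Quotient.idealrBE; apply/asboolP.
Qed.

Lemma tensorDl x x' y : tensor (x + x') y = tensor x y + tensor x' y.
Proof. by rewrite !tensorE -[RHS]raddfD; apply/tens_rel_eq/TensRelDl. Qed.

Lemma tensorDr x y y' : tensor x (y + y') = tensor x y + tensor x y'.
Proof. by rewrite !tensorE -[RHS]raddfD; apply/tens_rel_eq/TensRelDr. Qed.

Lemma tensorA x (a : R) y : tensor (x *:> a) y = tensor x (a *: y).
Proof. by rewrite !tensorE; apply/tens_rel_eq/TensRelA. Qed.

Section Lift.
Context (G : zmodType) (b : X -> Y -> G).

Definition balanced : Prop :=
  [/\ forall x x' y, b (x + x') y = b x y + b x' y,
      forall x y y', b x (y + y') = b x y + b x y' &
      forall x (a : R) y, b (x *:> a) y = b x (a *: y)].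

Definition tens_lift (t : tens) : G :=
  fglift (fun p => b p.1 p.2 : zmodule G) (repr t).
End Lift.

End Tensor.
Arguments tens_rel {R} X Y.
Arguments tens_ker {R} X Y.
Arguments tens {R} X Y.
Arguments balanced {R X Y G} b.
Arguments tens_lift {R X Y G} b t.

Section TensorTheory.
Context (R : pzRingType) (X : rmodType R) (Y : lmodType R).

Section Lift.
Context (G : zmodType) (b : X -> Y -> G) (b_bal : balanced b).
Local Notation lift := (fglift (fun p => b p.1 p.2 : zmodule G)).

Let lift1 x y : lift << (x, y) >> = b x y.
Proof. by rewrite liftU scale1r. Qed.

Let liftB : zmod_morphism lift. Proof. exact: lift_is_additive. Qed.

Let liftD u v : lift (u + v) = lift u + lift v.
Proof.
have lift0 : lift 0 = 0 by rewrite -(subrr 0) liftB subrr.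
by rewrite -{1}[v]opprK liftB -(sub0r v) liftB lift0 sub0r opprK.
Qed.

Lemma tens_lift_pi u :
  tens_lift b (\pi_(Quotient.quot (tens_ker X Y)) u) = lift u.
Proof.
have [bDl bDr bA] := b_bal.
have ker v : tens_rel X Y v -> lift v = 0.
  elim=> [|{}u {}v _ u0 _ v0|x x' y|x y y'|x a y]; rewrite ?liftB.
  - by rewrite -(subrr 0) liftB subrr.
  - by rewrite u0 v0 subrr.
  - by rewrite liftD !lift1 bDl subrr.
  - by rewrite liftD !lift1 bDr subrr.
  - by rewrite !lift1 bA subrr.
rewrite /tens_lift; case: piP => v /eqP.
rewrite -Quotient.idealrBE => /asboolP/ker.
by rewrite liftB => /eqP; rewrite subr_eq0 => /eqP.
Qed.

Lemma tens_lift_tensor x y : tens_lift b (tensor x y) = b x y.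
Proof. by rewrite tens_lift_pi lift1. Qed.

Lemma tens_liftD : {morph tens_lift b : s t / s + t}.
Proof.
move=> s t; rewrite -[s]reprK -[t]reprK -[in LHS]raddfD !tens_lift_pi.
exact: liftD.
Qed.
End Lift.

Lemma tens_ind (P : tens X Y -> Prop) :
    (forall x y, P (tensor x y)) -> (forall s t, P s -> P t -> P (s + t)) ->
  forall t, P t.
Proof.
move=> Pt PD t; rewrite -[t]reprK.
have P0 : P 0.
  suff <- : tensor (0 : X) (0 : Y) = 0 by exact: Pt.
  by apply: (addrI (tensor 0 0)); rewrite -tensorDl !addr0.
have PN x y : P (- tensor x y).
  suff -> : - tensor x y = tensor (- x) y by exact: Pt.
  apply: (addrI (tensor x y)); rewrite -tensorDl !subrr.
  by apply: (addrI (tensor 0 y)); rewrite -tensorDl !addr0.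
elim/freeg_ind_dom0: (repr t) => [|m [x y] u _ _ Pu]; first by rewrite raddf0.
rewrite raddfD; apply: (PD) => //.
rewrite -[m]intz -freegU_mulz raddfMz -[X in X *~ _]/(tensor x y).
case: m => n; first elim: n => [|n IHn].
- by rewrite mulr0z.
- by rewrite intS mulrzDr mulr1z; apply: (PD).
elim: n => [|n IHn]; first exact: PN.
rewrite NegzE -addn1 PoszD opprD mulrzDr -NegzE mulrN1z.
exact: (PD) (PN _ _).
Qed.

Lemma balanced_tensor (R' : pzRingType) (X' : rmodType R') (Y' : lmodType R')
    (f : X -> X') (g : Y -> Y') :
    {morph f : x y / x + y} -> {morph g : x y / x + y} ->
    (forall x (a : R) y, tensor (f (x *:> a)) (g y) = tensor (f x) (g (a *: y))) ->
  balanced (fun x y => tensor (f x) (g y)).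
Proof.
by move=> fD gD fg; split=> // *; rewrite ?fD ?gD ?tensorDl ?tensorDr.
Qed.

Lemma tens_ext (G : zmodType) (f g : tens X Y -> G) :
    {morph f : s t / s + t} -> {morph g : s t / s + t} ->
    (forall x y, f (tensor x y) = g (tensor x y)) -> f =1 g.
Proof.
move=> fD gD fg; elim/tens_ind => // s t fgs fgt.
by rewrite fD gD fgs fgt.
Qed.
End TensorTheory.

(* The right B-module X (x)_A M, with (x (x) m) b = x (x) m b *)
Definition rtens (k : fieldType) (A B : fdAlgType k)
  (X : rmodType A) (M : bimodType A B) : Type := tens X M.

Section TensorRightAction.
Context (k : fieldType) (A B : fdAlgType k) (X : rmodType A).
Context (M : bimodType A B).

HB.instance Definition _ := GRing.Zmodule.on (rtens X M).

Definition rtens_ract (t : rtens X M) (b : B) : rtens X M :=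
  tens_lift (fun x (m : M) => tensor x (ract m b)) t.

Let bal b : balanced (fun (x : X) (m : M) => tensor x (ract m b)).
Proof.
by apply: balanced_tensor => // [m n|x a m]; rewrite (ractDl, ractZ) ?tensorA.
Qed.

Lemma rtens_ractE x m b :
  rtens_ract (tensor x m) b = tensor x (ract m b).
Proof. exact: tens_lift_tensor. Qed.

Lemma rtens_ractDl b : {morph rtens_ract^~ b : s t / s + t}.
Proof. exact: tens_liftD. Qed.

Lemma rtens_ractA t b b' :
  rtens_ract (rtens_ract t b) b' = rtens_ract t (b * b').
Proof.
elim/tens_ind: t => [x m|s t IHs IHt]; first by rewrite !rtens_ractE ractA.
by rewrite !rtens_ractDl IHs IHt.
Qed.

Lemma rtens_ract1 t : rtens_ract t 1 = t.
Proof.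
elim/tens_ind: t => [x m|s t IHs IHt]; first by rewrite !rtens_ractE ract1.
by rewrite !rtens_ractDl IHs IHt.
Qed.

Lemma rtens_ractDr t : {morph rtens_ract t : b b' / b + b'}.
Proof.
move=> b b'; elim/tens_ind: t => [x m|s t IHs IHt].
  by rewrite !rtens_ractE ractDr tensorDr.
by rewrite !rtens_ractDl IHs IHt addrACA.
Qed.

Fact rtens_scaleA (b b' : B^c) (t : rtens X M) :
  rtens_ract (rtens_ract t (b' : B)) (b : B) = rtens_ract t (b * b' : B^c).
Proof. exact: rtens_ractA. Qed.

Fact rtens_scaleDl (t : rtens X M) :
  {morph (fun b : B^c => rtens_ract t (b : B)) : b b' / b + b'}.
Proof. exact: rtens_ractDr. Qed.

HB.instance Definition _ := GRing.Zmodule_isLmodule.Build (B^c) (rtens X M)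
  rtens_scaleA rtens_ract1 rtens_ractDl rtens_scaleDl.
End TensorRightAction.

(* The A-C-bimodule M (x)_B N *)
Definition bitens (k : fieldType) (A B C : fdAlgType k)
  (M : bimodType A B) (N : bimodType B C) : Type := tens (rside M) N.

Section BimoduleTensor.
Context (k : fieldType) (A B C : fdAlgType k).
Context (M : bimodType A B) (N : bimodType B C).

HB.instance Definition _ := GRing.Zmodule.on (bitens M N).

Definition bitens_lact (a : A) (t : bitens M N) : bitens M N :=
  tens_lift (fun (m : rside M) (n : N) =>
               tensor (a *: (m : M) : rside M) n) t.

Definition bitens_ract (t : bitens M N) (c : C) : bitens M N :=
  rtens_ract (t : rtens (rside M) N) c.

Let bal a :
  balanced (fun (m : rside M) (n : N) => tensor (a *: (m : M) : rside M) n).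
Proof.
apply: balanced_tensor => // [m n|m b n]; first exact: (@scalerDr _ M).
rewrite -tensorA; congr tensor; exact/esym/(@ractZ _ _ _ M).
Qed.

Lemma bitens_lactE a (m : M) n :
  bitens_lact a (tensor (m : rside M) n) = tensor (a *: m : rside M) n.
Proof. exact: tens_lift_tensor. Qed.

Lemma bitens_lactDr : right_distributive bitens_lact +%R.
Proof. by move=> a; apply: tens_liftD. Qed.

Lemma bitens_ractE (m : M) n c :
  bitens_ract (tensor (m : rside M) n) c = tensor (m : rside M) (ract n c).
Proof. exact: rtens_ractE. Qed.

Lemma bitens_ractDl c : {morph bitens_ract^~ c : s t / s + t}.
Proof. exact: rtens_ractDl. Qed.

Lemma bitens_lactA a b t :
  bitens_lact a (bitens_lact b t) = bitens_lact (a * b) t.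
Proof.
elim/tens_ind: t => [m n|s t IHs IHt]; first by rewrite !bitens_lactE scalerA.
by rewrite !bitens_lactDr IHs IHt.
Qed.

Lemma bitens_lact1 : left_id 1 bitens_lact.
Proof.
elim/tens_ind => [m n|s t IHs IHt]; first by rewrite !bitens_lactE scale1r.
by rewrite !bitens_lactDr IHs IHt.
Qed.

Lemma bitens_lactDl t : {morph bitens_lact^~ t : a b / a + b}.
Proof.
move=> a b /=; elim/tens_ind: t => [m n|s t IHs IHt].
  by rewrite !bitens_lactE scalerDl tensorDl.
by rewrite !bitens_lactDr IHs IHt addrACA.
Qed.

HB.instance Definition _ := GRing.Zmodule_isLmodule.Build A (bitens M N)
  bitens_lactA bitens_lact1 bitens_lactDr bitens_lactDl.

Lemma bitens_ractZ (a : A) (t : bitens M N) c :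
  bitens_ract (a *: t) c = a *: bitens_ract t c.
Proof.
rewrite -![_ *: _]/(bitens_lact _ _).
elim/tens_ind: t => [m n|s t IHs IHt].
  by rewrite !(bitens_ractE, bitens_lactE).
by rewrite !(bitens_ractDl, bitens_lactDr) IHs IHt.
Qed.

Lemma bitens_ract_central (c : k) (t : bitens M N) :
  bitens_ract t (inalg c) = (inalg c : A) *: t.
Proof.
rewrite -![_ *: _]/(bitens_lact _ _).
elim/tens_ind: t => [m n|s t IHs IHt].
  rewrite bitens_ractE bitens_lactE ract_central -tensorA; congr tensor.
  exact: (@ract_central _ _ _ M).
by rewrite !(bitens_ractDl, bitens_lactDr) IHs IHt.
Qed.

HB.instance Definition _ := Lmodule_isBimodule.Build k A C (bitens M N)
  (@rtens_ractA _ _ _ (rside M) N) (@rtens_ract1 _ _ _ (rside M) N)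
  bitens_ractDl (@rtens_ractDr _ _ _ (rside M) N)
  bitens_ractZ bitens_ract_central.
End BimoduleTensor.

Lemma linear_ext (R : pzRingType) (X Y : lmodType R) (f g : {linear X -> Y}) :
  f =1 g -> f = g.
Proof.
move: f g => [f [[fD] [fZ]]] [g [[gD] [gZ]]] fg.
have {fg}efg : f = g by apply: funext.
case: _ / efg gD gZ => gD gZ.
by rewrite (Prop_irrelevance fD gD) (Prop_irrelevance fZ gZ).
Qed.

Record modFunctor (R S : pzRingType) := ModFunctor {
  fobj :> lmodType R -> lmodType S;
  fmap : forall X Y : lmodType R, {linear X -> Y} -> {linear fobj X -> fobj Y};
  fmap_id : forall X : lmodType R, fmap (idfun : {linear X -> X}) =1 idfun;
  fmap_comp : forall (X Y Z : lmodType R)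
    (g : {linear Y -> Z}) (f : {linear X -> Y}),
    fmap (g \o f : {linear X -> Z}) =1 fmap g \o fmap f
}.

(* Bijections Hom(F X, Y) -> Hom(X, G Y), natural in X and Y *)
Definition left_adjoint (R S : pzRingType)
    (F : modFunctor R S) (G : modFunctor S R) : Prop :=
  exists phi : forall (X : lmodType R) (Y : lmodType S),
      {linear F X -> Y} -> {linear X -> G Y},
    (forall X Y, bijective (phi X Y)) /\
    (forall (X X' : lmodType R) (Y Y' : lmodType S)
       (u : {linear X' -> X}) (v : {linear Y -> Y'}) (f : {linear F X -> Y}),
       phi X' Y' (v \o (f \o fmap F u) : {linear F X' -> Y'})
         =1 fmap G v \o (phi X Y f \o u)).

Section TensorFunctor.
Context (k : fieldType) (A B : fdAlgType k) (M : bimodType A B).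

Section Map.
Context (X Y : rmodType A) (f : {linear X -> Y}).

Definition rtens_map (t : rtens X M) : rtens Y M :=
  tens_lift (fun x (m : M) => tensor (f x) m) t.

Let bal : balanced (fun x (m : M) => tensor (f x) m).
Proof.
by apply: balanced_tensor => // [x y|x a m]; rewrite (linearD, linearZ) ?tensorA.
Qed.

Lemma rtens_mapE x m : rtens_map (tensor x m) = tensor (f x) m.
Proof. exact: tens_lift_tensor. Qed.

Lemma rtens_mapD : {morph rtens_map : s t / s + t}.
Proof. exact: tens_liftD. Qed.

Lemma rtens_map_ract t b :
  rtens_map (rtens_ract t b) = rtens_ract (rtens_map t) b.
Proof.
elim/tens_ind: t => [x m|s t IHs IHt].
  by rewrite !(rtens_ractE, rtens_mapE).
by rewrite !(rtens_ractDl, rtens_mapD) IHs IHt.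
Qed.

Fact rtens_map_linear :
  linear (rtens_map : (rtens X M : rmodType B) -> (rtens Y M : rmodType B)).
Proof. by move=> b s t; rewrite rtens_mapD rtens_map_ract. Qed.

HB.instance Definition _ :=
  GRing.isLinear.Build (B^c) (rtens X M) (rtens Y M) _ rtens_map
    rtens_map_linear.
End Map.

Fact rtens_map_id (X : rmodType A) :
  rtens_map (idfun : {linear X -> X}) =1 idfun.
Proof.
by apply: tens_ext => [||x m] //; [exact: rtens_mapD|rewrite rtens_mapE].
Qed.

Fact rtens_map_comp (X Y Z : rmodType A)
    (g : {linear Y -> Z}) (f : {linear X -> Y}) :
  rtens_map (g \o f : {linear X -> Z}) =1 rtens_map g \o rtens_map f.
Proof.
apply: tens_ext => [|s t|x m] /=; first exact: rtens_mapD.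
  by rewrite !rtens_mapD.
by rewrite !rtens_mapE.
Qed.

Definition tensor_functor : modFunctor (A^c) (B^c) :=
  @ModFunctor (A^c) (B^c) (fun X => rtens X M) (fun X Y f => rtens_map f)
    rtens_map_id rtens_map_comp.
End TensorFunctor.

Section SeparableEquivalence.
Context (k : fieldType) (A B : fdAlgType k).

Definition fg_projective_sides (C D : fdAlgType k) (M : bimodType C D) : Prop :=
  [/\ fin_gen (M : lmodType C), projective (M : lmodType C),
      fin_gen (rside M : rmodType D) & projective (rside M : rmodType D)].

Definition separable_equivalence (M : bimodType A B) (N : bimodType B A) : Prop :=
  [/\ fg_projective_sides M, fg_projective_sides N,
      exists X : bimodType A A, bimod_iso (bitens M N) (A^o * X)%type &
      exists Y : bimodType B B, bimod_iso (bitens N M) (B^o * Y)%type].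

Definition separably_equivalent : Prop :=
  exists (M : bimodType A B) (N : bimodType B A), separable_equivalence M N.

Definition symmetrically_separably_equivalent : Prop :=
  exists (M : bimodType A B) (N : bimodType B A),
    [/\ separable_equivalence M N,
        left_adjoint (tensor_functor M) (tensor_functor N) &
        left_adjoint (tensor_functor N) (tensor_functor M)].
End SeparableEquivalence.

(* Main.v *)
Require Import Defs.
From HB Require Import structures.
From mathcomp Require Import all_boot all_algebra.
From mathcomp Require Import boolp functions.

(** Only the passage from a separable equivalence (M, N) to a symmetric one
    needs an argument.  Write M* and N* for the k-linear duals.  The pair
    M' = M (+) N*, N' = M* (+) N is a separable equivalence for a cheap reason:
    M and N are retracts of M' and N', so M (x) N is a retract of M' (x) N',
    and A, being a retract of M (x) N, is one of M' (x) N' as well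
    ([retract_bitens], [retract_trans]); a retract is a direct summand
    because the kernel of the retraction is a complement ([retract_summand]).

    Moreover N' is isomorphic to the dual of M', and this is where the symmetry
    of the algebras enters.  For a finitely generated projective right B-module
    M, the functor - (x) M has right adjoint - (x) Hom_B(M, B).  A
    nondegenerate trace form t on B identifies Hom_B(M, B) with M* by
    phi |-> t o phi, so the right adjoint is - (x) M* ([dual_pair_bdualr]).
    The trace form of A gives in the same way that - (x) M* is left adjoint to
    - (x) M ([dual_pair_bduall]).  The same holds for N, and adding the
    adjunctions for M and for N* ([dual_pair_dsum]) makes - (x) M' both left
    and right adjoint to - (x) N'.

    All adjunctions are handled through one elementary notion, [dual_pair]: a
    pairing N x M -> B together with a pair of dual bases.  It yields the
    adjunction by explicit formulas ([dual_pair_left_adjoint]), and also the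
    finite generation and projectivity of M' and N' on all four sides
    ([dual_pair_fgp]). *)

Set Implicit Arguments.
Unset Strict Implicit.
Unset Printing Implicit Defensive.

Import GRing.Theory.
Local Open Scope ring_scope.

(** * Additive functions and the zero action *)

(** The maps to which these two lemmas apply (coordinate functions, pairings,
    contractions) are plain functions without a bundled structure. *)
Lemma morph_add0 (U V : zmodType) (f : U -> V) :
  {morph f : x y / x + y} -> f 0 = 0.
Proof. by move=> fD; apply: (@addIr _ (f 0)); rewrite -fD !add0r. Qed.

Lemma morph_add_sum (U V : zmodType) (f : U -> V) (I : finType) (x : I -> U) :
  {morph f : x y / x + y} -> f (\sum_i x i) = \sum_i f (x i).
Proof. by move=> fD; exact: (big_morph f fD (morph_add0 fD)). Qed.

Lemma ract0 (k : fieldType) (A B : fdAlgType k) (M : bimodType A B) (b : B) :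
  ract (0 : M) b = 0.
Proof. exact: morph_add0 (ractDl b). Qed.

(** * Dual bases of projective modules *)

Section DualBasis.
Context (R : pzRingType) (P : lmodType R).

Definition dual_basis (I : finType) (e : I -> P) (phi : I -> P -> R) : Prop :=
  (forall i a p q, phi i (a *: p + q) = a * phi i p + phi i q) /\
  (forall p, p = \sum_i phi i p *: e i).

Section Theory.
Context (I : finType) (e : I -> P) (phi : I -> P -> R).
Context (phiP : dual_basis e phi).

Lemma dual_basisD i p q : phi i (p + q) = phi i p + phi i q.
Proof. by have [lin _] := phiP; have := lin i 1 p q; rewrite scale1r mul1r. Qed.

Lemma dual_basisZ i a p : phi i (a *: p) = a * phi i p.
Proof.
have [lin _] := phiP.
by rewrite -[a *: p]addr0 lin (morph_add0 (dual_basisD i)) addr0.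
Qed.

Lemma dual_basis_fin_gen : fin_gen P.
Proof.
have [_ eP] := phiP; exists #|I|, (e \o enum_val) => p.
exists (fun i => phi (enum_val i) p); rewrite [LHS]eP.
by rewrite (reindex (@enum_val _ I)) //=; apply: onW_bij; apply: enum_val_bij.
Qed.

Lemma dual_basis_projective : projective P.
Proof.
move=> X Y g f g_surj; have [lin eP] := phiP.
have [x gx] := choice (fun i => g_surj (f (e i))).
pose h p : X := \sum_i phi i p *: x i.
have h_lin : linear h.
  move=> a p q; rewrite /h scaler_sumr -big_split; apply: eq_bigr => i _ /=.
  by rewrite lin scalerDl scalerA.
pose hL := GRing.isLinear.Build _ _ _ _ h h_lin.
pose hl : {linear P -> X} := HB.pack h hL.
exists hl => p /=.
rewrite [in RHS](eP p) !linear_sum; apply: eq_bigr => i _.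
by rewrite !linearZ gx.
Qed.
End Theory.

(** The coordinates come from a splitting of the surjection R^n -> P given by
    a finite generating family. *)
Lemma projective_dual_basis : fin_gen P -> projective P ->
  exists n (e : 'I_n -> P) phi, dual_basis e phi.
Proof.
move=> [n [e gen_e]] proj_P.
pose g (c : {ffun 'I_n -> R^o}) : P := \sum_(i < n) (c i : R) *: e i.
have g_lin : linear g.
  move=> a c d; rewrite /g scaler_sumr -big_split; apply: eq_bigr => i _ /=.
  by rewrite !ffunE scalerDl scalerA.
pose gL := GRing.isLinear.Build _ _ _ _ g g_lin.
pose gl : {linear {ffun 'I_n -> R^o} -> P} := HB.pack g gL.
have [p|h gh] := proj_P _ _ gl (idfun : {linear P -> P}).
  by have [c ->] := gen_e p; exists [ffun i => c i]; apply: eq_bigr => i _;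
    rewrite ffunE.
exists n, e, (fun i p => h p i); split=> [i a p q|p].
  by rewrite linearP !ffunE.
exact/esym/gh.
Qed.

End DualBasis.

(** * The trace form of a symmetric algebra *)

Section SymmetricForm.
Context (k : fieldType) (A : fdAlgType k).

Definition kfunctional (P : lmodType A) (mu : P -> k) : Prop :=
  (forall p q, mu (p + q) = mu p + mu q) /\
  (forall c p, mu ((inalg c : A) *: p) = c * mu p).

(** The last two clauses say that sending a to the functional x |-> t (x a) is
    a bijection from A onto its k-dual. *)
Definition symmetric_form (t : A -> k) : Prop :=
  [/\ kfunctional (t : A^o -> k), forall x y, t (x * y) = t (y * x),
      forall a, (forall x, t (x * a) = 0) -> a = 0 &
      forall mu : A^o -> k, kfunctional mu ->
        exists a, forall x : A, mu x = t (x * a)].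

(** The form is the image t of 1 under an isomorphism f : A -> Hom_k(A, k).
    Left and right linearity give f a = a t = t a, which is the symmetry of t;
    nondegeneracy and representability are the bijectivity of f. *)
Lemma symmetric_algebra_form :
  symmetric_algebra A -> exists t, symmetric_form t.
Proof.
move=> [f [[g fK gK] fr]].
pose t x : k := f (1 : A^o) x.
have f_r a x : f a x = t (a * x).
  by rewrite -[a in LHS](mul1r a) -[1 * a]/(ract (1 : A^o) (a : A)) fr.
have f_l a x : f a x = t (x * a).
  by rewrite -[a in LHS](mulr1 a) -[_ * 1]/(a *: (1 : A^o)) linearZ.
exists t; split=> [|x y|a ta|mu [muD muZ]].
- by split=> [x y|c x]; [exact: dualD | exact: dualZ].
- by rewrite -f_r f_l.
- apply: (can_inj fK); rewrite linear0; apply: dual_ext => x.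
  by rewrite f_l ta.
- have mu_lin : (mu : A -> k^o) \in @klinear_pred k A by apply/asboolP.
  by exists (g (Dual mu_lin)) => x; rewrite -f_l gK.
Qed.

Lemma symmetric_form_inj t a b : symmetric_form t ->
  (forall x, t (x * a) = t (x * b)) -> a = b.
Proof.
move=> [[tD _] _ t0 _] tab; apply/eqP; rewrite -subr_eq0; apply/eqP.
apply: t0 => x; apply: (@addIr _ (t (x * b))).
by rewrite -tD -mulrDr subrK add0r.
Qed.
End SymmetricForm.


(** * Dual pairs of bimodules *)

(** The conditions make e a B-B-bimodule map from the tensor product of N and
    M over A to B. *)
Definition bimodule_pairing (k : fieldType) (A B : fdAlgType k)
    (M : bimodType A B) (N : bimodType B A) (e : N -> M -> B) : Prop :=
  [/\ forall n n' m, e (n + n') m = e n m + e n' m,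
      forall n m m', e n (m + m') = e n m + e n m',
      forall b n m, e (b *: n) m = b * e n m,
      forall n m b, e n (ract m b) = e n m * b &
      forall n a m, e (ract n a) m = e n (a *: m)].

(** The element \sum_i m_i (x) n_i of M (x) N and the pairing e are the unit
    and the counit of an adjunction, and the two dual basis identities are its
    triangle identities.  They force the element to commute with A, as a unit
    map from A to M (x) N demands; see [unit_adjunct_scale]. *)
Definition dual_pair (k : fieldType) (A B : fdAlgType k)
    (M : bimodType A B) (N : bimodType B A) : Prop :=
  exists (e : N -> M -> B) (I : finType) (m_ : I -> M) (n_ : I -> N),
  [/\ bimodule_pairing e,
      forall m, m = \sum_i ract (m_ i) (e (n_ i) m) &
      forall n, n = \sum_i e n (m_ i) *: n_ i].

(** * The adjunction of a dual pair *)

Section TensorSums.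
Context (R : pzRingType) (X : rmodType R) (Y : lmodType R).

Lemma tensor_suml (I : finType) (x : I -> X) (y : Y) :
  tensor (\sum_i x i) y = \sum_i tensor (x i) y.
Proof.
by apply: (@morph_add_sum _ _ (fun x => tensor x y)) => u v; exact: tensorDl.
Qed.

Lemma tensor_sumr (I : finType) (x : X) (y : I -> Y) :
  tensor x (\sum_i y i) = \sum_i tensor x (y i).
Proof. by apply: morph_add_sum => u v; exact: tensorDr. Qed.
End TensorSums.

Section Adjunction.
Context (k : fieldType) (A B : fdAlgType k).
Context (M : bimodType A B) (N : bimodType B A).
Context (e : N -> M -> B) (I : finType) (m_ : I -> M) (n_ : I -> N).
Context (eP : bimodule_pairing e).
Context (m_P : forall m, m = \sum_i ract (m_ i) (e (n_ i) m)).
Context (n_P : forall n, n = \sum_i e n (m_ i) *: n_ i).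

Section Objects.
Context (X : rmodType A) (Y : rmodType B).

Let rtensZ (x : X) m b :
  (tensor x m : rtens X M) *:> b = tensor x (ract m b) :> rtens X M.
Proof. exact: rtens_ractE. Qed.

Definition unit_adjunct (f : {linear rtens X M -> Y}) (x : X) : rtens Y N :=
  \sum_i tensor (f (tensor x (m_ i))) (n_ i).

Lemma unit_adjunct_additive f : {morph unit_adjunct f : x y / x + y}.
Proof.
move=> x y; rewrite /unit_adjunct -big_split; apply: eq_bigr => i _ /=.
by rewrite tensorDl linearD tensorDl.
Qed.

(** This is where \sum_i m_i (x) n_i is seen to commute with A: expand a m_i
    along the m_j, move the coefficient e(n_j, a m_i) = e(n_j a, m_i) across
    the tensor sign, and recognize the expansion of n_j a along the n_i. *)
Lemma unit_adjunct_scale f a x :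
  unit_adjunct f (x *:> a) = unit_adjunct f x *:> a.
Proof.
have [_ _ _ _ ebal] := eP.
have -> : unit_adjunct f x *:> a =
    \sum_i tensor (f (tensor x (m_ i))) (ract (n_ i) a).
  rewrite /unit_adjunct scaler_sumr; apply: eq_bigr => i _.
  exact: rtens_ractE.
transitivity (\sum_i \sum_j
    tensor (f (tensor x (m_ j))) (e (ract (n_ j) a) (m_ i) *: n_ i)).
  apply: eq_bigr => i _; rewrite tensorA [in LHS](m_P ((a : A) *: m_ i)).
  rewrite tensor_sumr linear_sum tensor_suml; apply: eq_bigr => j _.
  by rewrite -tensorA ebal -linearZ /= rtensZ.
rewrite exchange_big; apply: eq_bigr => j _.
by rewrite -tensor_sumr -n_P.
Qed.

Lemma unit_adjunct_linear f : linear (unit_adjunct f).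
Proof.
by move=> a x y; rewrite unit_adjunct_additive unit_adjunct_scale.
Qed.

HB.instance Definition _ f := GRing.isLinear.Build (A^c) X (rtens Y N) _
  (unit_adjunct f) (unit_adjunct_linear f).

(** The action on Y of the pairing of m with the N-component; the transpose of
    g sends x (x) m to the contraction of g x by m. *)
Definition contract (m : M) : rtens Y N -> Y :=
  tens_lift (fun (y : Y) n => y *:> e n m).

Let contract_bal m : balanced (fun (y : Y) n => y *:> e n m).
Proof.
have [eDl _ eZl _ _] := eP; split=> [y y' n|y n n'|y b n].
- by rewrite scalerDr.
- by rewrite eDl scalerDl.
- by rewrite scalerA eZl.
Qed.

Lemma contractE m y n : contract m (tensor y n) = y *:> e n m.
Proof. exact: tens_lift_tensor. Qed.

Lemma contractD m : {morph contract m : s t / s + t}.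
Proof. exact: tens_liftD. Qed.

Lemma contract_sum m (J : finType) (t : J -> rtens Y N) :
  contract m (\sum_j t j) = \sum_j contract m (t j).
Proof. exact: morph_add_sum (contractD m). Qed.

Lemma contract_addm m m' t : contract (m + m') t = contract m t + contract m' t.
Proof.
have [_ eDr _ _ _] := eP; elim/tens_ind: t => [y n|s t IHs IHt].
  by rewrite !contractE eDr scalerDl.
by rewrite !contractD IHs IHt addrACA.
Qed.

Lemma contract_ract m b t : contract (ract m b) t = contract m t *:> b.
Proof.
have [_ _ _ eZr _] := eP; elim/tens_ind: t => [y n|s t IHs IHt].
  by rewrite !contractE eZr scalerA.
by rewrite !contractD IHs IHt scalerDr.
Qed.

Lemma contract_scale m a t : contract (a *: m) t = contract m (t *:> a).
Proof.
have [_ _ _ _ ebal] := eP; elim/tens_ind: t => [y n|s t IHs IHt].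
  by rewrite [(tensor y n : rtens Y N) *:> a]rtens_ractE !contractE ebal.
by rewrite scalerDr !contractD IHs IHt.
Qed.

Definition counit_adjunct (g : {linear X -> rtens Y N}) : rtens X M -> Y :=
  tens_lift (fun x m => contract m (g x)).

Let counit_bal (g : {linear X -> rtens Y N}) :
  balanced (fun x m => contract m (g x)).
Proof.
split=> [x x' m|x m m'|x a m].
- by rewrite linearD contractD.
- exact: contract_addm.
- by rewrite linearZ contract_scale.
Qed.

Lemma counit_adjunctE g x m : counit_adjunct g (tensor x m) = contract m (g x).
Proof. exact: tens_lift_tensor. Qed.

Lemma counit_adjunctD g : {morph counit_adjunct g : s t / s + t}.
Proof. exact: tens_liftD. Qed.

Lemma counit_adjunct_linear g : linear (counit_adjunct g).
Proof.
move=> b s t; rewrite counit_adjunctD; congr (_ + _).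
elim/tens_ind: s => [x m|s s' IHs IHs']; last first.
  by rewrite scalerDr !counit_adjunctD scalerDr IHs IHs'.
by rewrite rtensZ !counit_adjunctE contract_ract.
Qed.

HB.instance Definition _ g := GRing.isLinear.Build (B^c) (rtens X M) Y _
  (counit_adjunct g) (counit_adjunct_linear g).

Lemma unit_adjunctK (f : {linear rtens X M -> Y}) :
  counit_adjunct (unit_adjunct f) =1 f.
Proof.
apply: tens_ext => [||x m]; [exact: counit_adjunctD | exact: (raddfD f) |].
rewrite counit_adjunctE /= /unit_adjunct contract_sum.
rewrite [in RHS](m_P m) tensor_sumr linear_sum; apply: eq_bigr => i _.
by rewrite contractE -linearZ /= rtensZ.
Qed.

Lemma contractK (t : rtens Y N) :
  \sum_i tensor (contract (m_ i) t) (n_ i) = t :> rtens Y N.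
Proof.
elim/tens_ind: t => [y n|s t IHs IHt].
  rewrite [in RHS](n_P n) tensor_sumr; apply: eq_bigr => i _.
  by rewrite contractE tensorA.
rewrite -[in RHS]IHs -[in RHS]IHt -big_split; apply: eq_bigr => i _ /=.
by rewrite contractD tensorDl.
Qed.

Lemma counit_adjunctK (g : {linear X -> rtens Y N}) :
  unit_adjunct (counit_adjunct g) =1 g.
Proof.
move=> x; rewrite -[RHS]contractK /unit_adjunct; apply: eq_bigr => i _ /=.
by rewrite counit_adjunctE.
Qed.
End Objects.

Lemma adjunction_of_pairing :
  left_adjoint (tensor_functor M) (tensor_functor N).
Proof.
exists (fun X Y f => unit_adjunct f); split=> [X Y|X X' Y Y' u v f x].
  exists (fun g => counit_adjunct g : {linear rtens X M -> Y}) => [f|g];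
    apply: linear_ext.
    exact: unit_adjunctK.
  exact: counit_adjunctK.
rewrite /= /unit_adjunct.
rewrite [RHS](raddf_sum (rtens_map (M := N) v : {linear _ -> _})).
apply: eq_bigr => i _.
by rewrite /= rtens_mapE [RHS]rtens_mapE.
Qed.
End Adjunction.

Lemma dual_pair_left_adjoint (k : fieldType) (A B : fdAlgType k)
    (M : bimodType A B) (N : bimodType B A) :
  dual_pair M N -> left_adjoint (tensor_functor M) (tensor_functor N).
Proof. by move=> [e [I [m_ [n_ []]]]]; exact: adjunction_of_pairing. Qed.

(** * The k-dual of a bimodule *)

(** As for the dual of an algebra, the actions are (b f)(m) = f (m b) and
    (f a)(m) = f (a m). *)
Section BimoduleDual.
Context (k : fieldType) (A B : fdAlgType k) (M : bimodType A B).

Definition bdual_pred : {pred M -> k^o} :=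
  fun f => `[< kfunctional f >].

Fact bdual_zmod_closed : zmod_closed bdual_pred.
Proof.
split=> [|f g /asboolP[fD fZ] /asboolP[gD gZ]]; apply/asboolP; split.
- by move=> p q; exact: esym (addr0 _).
- by move=> c p; exact: esym (mulr0 _).
- move=> p q; apply: etrans (congr2 _ (fD p q) (congr1 _ (gD p q))) _.
  by rewrite opprD addrACA.
- move=> c p; apply: etrans (congr2 _ (fZ c p) (congr1 _ (gZ c p))) _.
  by rewrite -mulrBr.
Qed.

HB.instance Definition _ :=
  GRing.isZmodClosed.Build (M -> k^o) bdual_pred bdual_zmod_closed.

Record bdual := BDual {bdual_fun :> M -> k^o; _ : bdual_fun \in bdual_pred}.
HB.instance Definition _ := [isSub for bdual_fun].
HB.instance Definition _ := [Choice of bdual by <:].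
HB.instance Definition _ := [SubChoice_isSubZmodule of bdual by <:].

Lemma bdual_ext (f g : bdual) : f =1 g -> f = g.
Proof. by move=> fg; apply/val_inj/funext. Qed.

Lemma bdual_kfunctional (f : bdual) : kfunctional f.
Proof. by case: f => f /= /asboolP. Qed.

Lemma bdualD (f : bdual) p q : f (p + q) = f p + f q.
Proof. by have [fD _] := bdual_kfunctional f. Qed.

Fact bdual_lact_subproof b (f : bdual) : (fun m => f (ract m b)) \in bdual_pred.
Proof.
have [fD fZ] := bdual_kfunctional f.
by apply/asboolP; split=> [p q|c p]; rewrite ?ractDl ?ractZ.
Qed.
Definition bdual_lact b f : bdual := BDual (bdual_lact_subproof b f).

Fact bdual_ract_subproof (f : bdual) (a : A) :
  (fun m => f (a *: m)) \in bdual_pred.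
Proof.
have [fD fZ] := bdual_kfunctional f; apply/asboolP; split=> [p q|c p].
  by rewrite scalerDr.
by rewrite scalerA -inalg_central -scalerA fZ.
Qed.
Definition bdual_ract f a : bdual := BDual (bdual_ract_subproof f a).

Fact bdual_lactA a b f : bdual_lact a (bdual_lact b f) = bdual_lact (a * b) f.
Proof. by apply: bdual_ext => x /=; rewrite ractA. Qed.
Fact bdual_lact1 : left_id 1 bdual_lact.
Proof. by move=> f; apply: bdual_ext => x /=; rewrite ract1. Qed.
Fact bdual_lactDr : right_distributive bdual_lact +%R.
Proof. by move=> a f g; apply: bdual_ext. Qed.
Fact bdual_lactDl f : {morph bdual_lact^~ f : a b / a + b}.
Proof. by move=> a b; apply: bdual_ext => x /=; rewrite ractDr bdualD. Qed.

HB.instance Definition _ := GRing.Zmodule_isLmodule.Build B bdual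
  bdual_lactA bdual_lact1 bdual_lactDr bdual_lactDl.

Fact bdual_ractA f b b' : bdual_ract (bdual_ract f b) b' = bdual_ract f (b * b').
Proof. by apply: bdual_ext => x /=; rewrite scalerA. Qed.
Fact bdual_ract1 f : bdual_ract f 1 = f.
Proof. by apply: bdual_ext => x /=; rewrite scale1r. Qed.
Fact bdual_ractDl b : {morph bdual_ract^~ b : f g / f + g}.
Proof. by move=> f g; apply: bdual_ext. Qed.
Fact bdual_ractDr f : {morph bdual_ract f : b b' / b + b'}.
Proof. by move=> b b'; apply: bdual_ext => x /=; rewrite scalerDl bdualD. Qed.
Fact bdual_ractZ (b : B) f a : bdual_ract (b *: f) a = b *: bdual_ract f a.
Proof. by apply: bdual_ext => x /=; rewrite ractZ. Qed.
Fact bdual_ract_central (c : k) f :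
  bdual_ract f (inalg c) = (inalg c : B) *: f.
Proof. by apply: bdual_ext => x /=; rewrite ract_central. Qed.

HB.instance Definition _ := Lmodule_isBimodule.Build k B A bdual
  bdual_ractA bdual_ract1 bdual_ractDl bdual_ractDr bdual_ractZ
  bdual_ract_central.
End BimoduleDual.

(** * Dual pairs over symmetric algebras *)

Section DualPairs.
Context (k : fieldType) (A B : fdAlgType k) (M : bimodType A B).

Lemma bdual_sum (f : bdual M) (I : finType) (m : I -> M) :
  f (\sum_i m i) = \sum_i f (m i).
Proof. exact: morph_add_sum (bdualD f). Qed.

Lemma bdual_sumE (I : finType) (f : I -> bdual M) m :
  (\sum_i f i) m = \sum_i f i m.
Proof. by apply: (big_morph (fun f : bdual M => f m)). Qed.

(** For f in M* and m in M, the functional b |-> f (m b) on B is t (- a) for a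
    unique a, and this a is the value e(f, m) of the pairing.  If (m_i, phi_i)
    is a dual basis of M over B, the dual basis of M* is (t o phi_i), because
    e(t o phi_i, m) = phi_i(m) by the symmetry of t. *)
Lemma dual_pair_bdualr : symmetric_algebra B ->
    fin_gen (rside M : rmodType B) -> projective (rside M : rmodType B) ->
  dual_pair M (bdual M).
Proof.
move=> /symmetric_algebra_form[t t_sym] M_fg M_proj.
have [[tD tZ] tC _ tP] := t_sym.
have [n [m_ [phi phiP]]] := projective_dual_basis M_fg M_proj.
have phiZ i (m : M) b : phi i (ract m b) = (phi i m : B) * b :> B.
  exact: (dual_basisZ phiP).
have phiD i (m m' : M) : phi i (m + m') = (phi i m : B) + phi i m' :> B.
  exact: (dual_basisD phiP).
have [_ m_P] := phiP.
have rep (fm : bdual M * M) : exists a : B,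
    forall b, fm.1 (ract fm.2 b) = t (b * a).
  have [fD fZ] := bdual_kfunctional fm.1.
  apply: (tP (fun b => fm.1 (ract fm.2 b))).
  split=> [b b'|c b]; first by rewrite ractDr fD.
  by rewrite -[_ *: _]/(_ * _) inalg_central -ractA ract_central fZ.
(* e is defined by the identity eE and determined by it, as e_eq says; the
   axioms of a pairing are all read off from this characterization. *)
have [e' e'E] := choice rep; pose e f m := e' (f, m).
have eE (f : bdual M) m b : f (ract m b) = t (b * e f m) := e'E (f, m) b.
have e_eq (f : bdual M) m a : (forall b, f (ract m b) = t (b * a)) -> e f m = a.
  by move=> fm; apply: (symmetric_form_inj t_sym) => b; rewrite -eE.
have kfun i : kfunctional (fun m : M => t (phi i m)).
  split=> [m m'|c m]; first by rewrite phiD tD.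
  by rewrite -ract_central phiZ -inalg_central tZ.
have in_bdual i : (fun m : M => t (phi i m)) \in @bdual_pred k A B M.
  exact/asboolP.
pose n_ i := BDual (in_bdual i).
have n_E i m : e (n_ i) m = phi i m.
  by apply: e_eq => b; rewrite /= phiZ tC.
exists e, 'I_n, m_, n_; split=> [|m|f].
- split=> [f g m|f m m'|b f m|f m b|f a m]; apply: e_eq => x.
  + by rewrite mulrDr tD -!eE.
  + by rewrite ractDl bdualD !eE -tD -mulrDr.
  + rewrite -[LHS]/(f (ract (ract m x) b)) ractA eE.
    by rewrite mulrA.
  + by rewrite ractA eE -mulrA tC -mulrA.
  + by rewrite -eE ractZ.
- by rewrite [LHS]m_P; apply: eq_bigr => i _; rewrite n_E.
- apply: bdual_ext => m; rewrite bdual_sumE [in LHS](m_P m) bdual_sum.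
  apply: eq_bigr => i _.
  rewrite -[RHS]/(t (phi i (ract m (e f (m_ i))))) phiZ.
  exact: eE.
Qed.

(** The mirror image: e(m, f) is the element a of A with f (x m) = t (x a) for
    all x in A, and the dual basis is obtained from one of M as a left
    A-module. *)
Lemma dual_pair_bduall : symmetric_algebra A ->
    fin_gen (M : lmodType A) -> projective (M : lmodType A) ->
  dual_pair (bdual M) M.
Proof.
move=> /symmetric_algebra_form[t t_sym] M_fg M_proj.
have [[tD tZ] tC _ tP] := t_sym.
have [n [m_ [phi phiP]]] := projective_dual_basis M_fg M_proj.
have phiZ := dual_basisZ phiP.
have phiD := dual_basisD phiP.
have [_ m_P] := phiP.
have rep (mf : M * bdual M) : exists a : A,
    forall x, mf.2 (x *: mf.1) = t (x * a).
  have [fD fZ] := bdual_kfunctional mf.2.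
  apply: (tP (fun x => mf.2 ((x : A) *: mf.1))).
  by split=> [x x'|c x]; [rewrite scalerDl fD | rewrite -scalerA fZ].
have [e' e'E] := choice rep; pose e m f := e' (m, f).
have eE m (f : bdual M) x : f (x *: m) = t (x * e m f) := e'E (m, f) x.
have e_eq m (f : bdual M) a : (forall x, f (x *: m) = t (x * a)) -> e m f = a.
  by move=> fm; apply: (symmetric_form_inj t_sym) => x; rewrite -eE.
have kfun i : kfunctional (fun m : M => t (phi i m)).
  by split=> [m m'|c m]; [rewrite phiD tD | rewrite phiZ tZ].
have in_bdual i : (fun m : M => t (phi i m)) \in @bdual_pred k A B M.
  exact/asboolP.
pose n_ i := BDual (in_bdual i).
have n_E i m : e m (n_ i) = phi i m by apply: e_eq => x; rewrite /= phiZ.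
exists e, 'I_n, n_, m_; split=> [|f|m].
- split=> [m m' f|m f g|a m f|m f a|m b f]; apply: e_eq => x.
  + by rewrite scalerDr bdualD !eE -tD -mulrDr.
  + by rewrite mulrDr tD -!eE.
  + by rewrite scalerA eE mulrA.
  + rewrite -[LHS]/(f (a *: (x *: m))) scalerA eE.
    by rewrite -mulrA tC -mulrA.
  + by rewrite -eE -ractZ.
- apply: bdual_ext => m; rewrite bdual_sumE [in LHS](m_P m) bdual_sum.
  apply: eq_bigr => i _.
  rewrite -[RHS]/(t (phi i (e (m_ i) f *: m))) phiZ tC.
  exact: eE.
- by rewrite [LHS]m_P; apply: eq_bigr => i _; rewrite n_E.
Qed.
End DualPairs.

(** * Consequences and sums of dual pairs *)

(** The two identities of a dual pair are dual bases of M, with coordinates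
    e(n_i, -), and of N, with coordinates e(-, m_i). *)
Lemma dual_pair_fgp (k : fieldType) (A B : fdAlgType k)
    (M : bimodType A B) (N : bimodType B A) : dual_pair M N ->
  [/\ fin_gen (rside M : rmodType B), projective (rside M : rmodType B),
      fin_gen (N : lmodType B) & projective (N : lmodType B)].
Proof.
move=> [e [I [m_ [n_ [[eDl eDr eZl eZr _] m_P n_P]]]]].
have Mb : dual_basis (m_ : I -> rside M) (fun i m => e (n_ i) m : B^c).
  by split=> [i b m m'|m]; [rewrite eDr; congr (_ + _); exact: eZr | exact: m_P].
have Nb : dual_basis n_ (fun i n => e n (m_ i)).
  by split=> [i b n n'|n]; [rewrite eDl eZl | exact: n_P].
split; [exact: dual_basis_fin_gen Mb | exact: dual_basis_projective Mb |
  exact: dual_basis_fin_gen Nb | exact: dual_basis_projective Nb].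
Qed.

(** The orthogonal sum of the two pairings, with the dual bases put together. *)
Lemma dual_pair_dsum (k : fieldType) (A B : fdAlgType k)
    (M M' : bimodType A B) (N N' : bimodType B A) :
  dual_pair M N -> dual_pair M' N' -> dual_pair (M * M')%type (N * N')%type.
Proof.
move=> [e [I [m_ [n_ [[eDl eDr eZl eZr eB] m_P n_P]]]]].
move=> [e' [I' [m'_ [n'_ [[e'Dl e'Dr e'Zl e'Zr e'B] m'_P n'_P]]]]].
have e0 n : e n 0 = 0 := morph_add0 (eDr n).
have e'0 n : e' n 0 = 0 := morph_add0 (e'Dr n).
have e0l m : e 0 m = 0 by apply: (@morph_add0 _ _ (e^~ m)) => n n'; exact: eDl.
have e'0l m : e' 0 m = 0.
  by apply: (@morph_add0 _ _ (e'^~ m)) => n n'; exact: e'Dl.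
exists (fun n m => e n.1 m.1 + e' n.2 m.2), (I + I')%type.
exists (fun i => match i with inl i => (m_ i, 0) | inr i => (0, m'_ i) end).
exists (fun i => match i with inl i => (n_ i, 0) | inr i => (0, n'_ i) end).
split.
- split=> [n n' m|n m m'|b n m|n m b|n a m] /=.
  + by rewrite eDl e'Dl addrACA.
  + by rewrite eDr e'Dr addrACA.
  + by rewrite eZl e'Zl mulrDr.
  + by rewrite eZr e'Zr mulrDl.
  + by rewrite eB e'B.
- move=> [m m']; rewrite big_sumType /= [RHS]surjective_pairing.
  congr pair; rewrite raddfD !raddf_sum /=.
    rewrite [X in _ + X]big1 => [|i _]; last exact: ract0.
    by rewrite addr0 [LHS]m_P; apply: eq_bigr => i _; rewrite e'0l addr0.
  rewrite [X in X + _]big1 => [|i _]; last exact: ract0.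
  by rewrite add0r [LHS]m'_P; apply: eq_bigr => i _; rewrite e0l add0r.
- move=> [n n']; rewrite big_sumType /= [RHS]surjective_pairing.
  congr pair; rewrite raddfD !raddf_sum /=.
    rewrite [X in _ + X]big1 => [|i _]; last exact: scaler0.
    by rewrite addr0 [LHS]n_P; apply: eq_bigr => i _; rewrite e'0 addr0.
  rewrite [X in X + _]big1 => [|i _]; last exact: scaler0.
  by rewrite add0r [LHS]n'_P; apply: eq_bigr => i _; rewrite e0 add0r.
Qed.

(** * Retracts and direct summands *)

Section Retracts.
Context (k : fieldType).

(** Bundling right linearity lets the kernel of p carry its bimodule structure
    as a canonical instance inferred from p alone. *)
Record bimod_hom (A B : fdAlgType k) (M N : bimodType A B) := BimodHom {
  bhom :> {linear M -> N};
  bhom_ract : forall m b, bhom (ract m b) = ract (bhom m) b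
}.

Definition retract (A B : fdAlgType k) (M N : bimodType A B) : Prop :=
  exists (i : bimod_hom M N) (p : bimod_hom N M), cancel i p.

Section Kernel.
Context (A B : fdAlgType k) (T U : bimodType A B) (p : bimod_hom T U).

Definition ker_pred : {pred T} := fun x => p x == 0.

Fact ker_submod_closed : submod_closed ker_pred.
Proof.
split=> [|a x y]; rewrite !unfold_in ?linear0 // => /eqP px /eqP py.
by rewrite linearP px py scaler0 addr0.
Qed.
HB.instance Definition _ :=
  GRing.isSubmodClosed.Build A T ker_pred ker_submod_closed.

Record bker := BKer {bker_val : T; _ : bker_val \in ker_pred}.
HB.instance Definition _ := [isSub for bker_val].
HB.instance Definition _ := [Choice of bker by <:].
HB.instance Definition _ := [SubChoice_isSubLmodule of bker by <:].

Lemma bker_valP (x : bker) : p (bker_val x) = 0.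
Proof. by case: x => x /= /eqP. Qed.

Fact bker_ract_subproof (x : bker) b : ract (bker_val x) b \in ker_pred.
Proof.
by rewrite unfold_in bhom_ract bker_valP ract0.
Qed.
Definition bker_ract x b : bker := BKer (bker_ract_subproof x b).

Fact bker_ractA x b b' : bker_ract (bker_ract x b) b' = bker_ract x (b * b').
Proof. by apply: val_inj; rewrite /= ractA. Qed.
Fact bker_ract1 x : bker_ract x 1 = x.
Proof. by apply: val_inj; rewrite /= ract1. Qed.
Fact bker_ractDl b : {morph bker_ract^~ b : x y / x + y}.
Proof. by move=> x y; apply: val_inj; rewrite /= ractDl. Qed.
Fact bker_ractDr x : {morph bker_ract x : b b' / b + b'}.
Proof. by move=> b b'; apply: val_inj; rewrite /= ractDr. Qed.
Fact bker_ractZ (a : A) x b : bker_ract (a *: x) b = a *: bker_ract x b.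
Proof. by apply: val_inj; rewrite /= ractZ. Qed.
Fact bker_ract_central (c : k) x : bker_ract x (inalg c) = (inalg c : A) *: x.
Proof. by apply: val_inj; rewrite /= ract_central. Qed.

HB.instance Definition _ := Lmodule_isBimodule.Build k A B bker
  bker_ractA bker_ract1 bker_ractDl bker_ractDr bker_ractZ bker_ract_central.
End Kernel.

(** For an inclusion i and a retraction p, T is the sum of U and the kernel of
    p by x |-> (p x, x - i (p x)). *)
Lemma retract_summand (A B : fdAlgType k) (U T : bimodType A B) :
  retract U T -> exists X : bimodType A B, bimod_iso T (U * X)%type.
Proof.
move=> [i [p ipK]]; exists (bker p).
have in_ker x : x - i (p x) \in ker_pred p.
  by rewrite unfold_in linearB ipK subrr.
pose f x : U * bker p := (p x, BKer (in_ker x)).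
have f_lin : linear f.
  move=> a x y; congr pair; first exact: linearP.
  by apply: val_inj; rewrite /= !linearP scalerDr addrACA.
pose fL := GRing.isLinear.Build _ _ _ _ f f_lin.
pose fl : {linear T -> (U * bker p)%type} := HB.pack f fL.
exists fl; split=> [|x b].
  exists (fun y : U * bker p => i y.1 + bker_val y.2) => [x|[u x]] /=.
    by rewrite addrC subrK.
  have pE : p (i u + bker_val x) = u by rewrite linearD ipK bker_valP addr0.
  by congr pair => //; apply: val_inj; rewrite /= pE addrC addKr.
congr pair; first exact: bhom_ract.
apply: val_inj; rewrite /= !bhom_ract.
apply: (@addIr _ (ract (i (p x)) b)).
by rewrite -ractDl !subrK.
Qed.

Lemma summand_retract (A B : fdAlgType k) (U T X : bimodType A B) :
  bimod_iso T (U * X)%type -> retract U T.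
Proof.
move=> [f [[g fK gK] f_ract]].
have g_lin : linear g.
  by move=> a x y; apply: (can_inj fK); rewrite linearP !gK.
have g_ract y b : g (ract y b) = ract (g y) b.
  by apply: (can_inj fK); rewrite f_ract !gK.
pose i u := g (u, 0 : X).
have i_lin : linear i.
  by move=> a u v; rewrite /i -g_lin; congr (g (_, _)); rewrite /= scaler0 addr0.
pose il : {linear U -> T} := HB.pack i (GRing.isLinear.Build _ _ _ _ i i_lin).
have i_ract u b : il (ract u b) = ract (il u) b.
  by rewrite /= /i -g_ract; congr (g (_, _)); rewrite /= ract0.
pose pr x := (f x).1.
have p_lin : linear pr by move=> a x y; rewrite /pr linearP.
pose pl : {linear T -> U} := HB.pack pr (GRing.isLinear.Build _ _ _ _ pr p_lin).
have p_ract x b : pl (ract x b) = ract (pl x) b by rewrite /= /pr f_ract.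
by exists (BimodHom i_ract), (BimodHom p_ract) => u; rewrite /= /pr /i gK.
Qed.

Lemma retract_trans (A B : fdAlgType k) (U V W : bimodType A B) :
  retract U V -> retract V W -> retract U W.
Proof.
move=> [i [p ipK]] [j [q jqK]].
have ji_ract m b : (j \o i : {linear U -> W}) (ract m b) = ract ((j \o i) m) b.
  by rewrite /= !bhom_ract.
have pq_ract m b : (p \o q : {linear W -> U}) (ract m b) = ract ((p \o q) m) b.
  by rewrite /= !bhom_ract.
by exists (BimodHom ji_ract), (BimodHom pq_ract) => x; rewrite /= jqK ipK.
Qed.

Lemma retract_dsuml (A B : fdAlgType k) (M N : bimodType A B) :
  retract M (M * N)%type.
Proof.
apply: (@summand_retract _ _ _ _ N); exists idfun; split=> //.
Qed.

Lemma retract_dsumr (A B : fdAlgType k) (M N : bimodType A B) :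
  retract N (M * N)%type.
Proof.
pose f (x : M * N) : N * M := (x.2, x.1).
have f_lin : linear f by [].
pose fl : {linear (M * N)%type -> (N * M)%type} :=
  HB.pack f (GRing.isLinear.Build _ _ _ _ f f_lin).
apply: (@summand_retract _ _ _ _ M); exists fl; split=> //.
by exists (fun x => (x.2, x.1)) => -[].
Qed.

Section TensorMap.
Context (A B C : fdAlgType k) (M M' : bimodType A B) (N N' : bimodType B C).
Context (f : bimod_hom M M') (g : bimod_hom N N').

Definition bitens_map : bitens M N -> bitens M' N' :=
  tens_lift (fun (m : rside M) (n : N) => tensor (f m : rside M') (g n)).

Let bal : balanced (fun (m : rside M) (n : N) => tensor (f m : rside M') (g n)).
Proof.
apply: balanced_tensor => [||m b n]; [exact: (raddfD f) | exact: linearD |].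
rewrite linearZ -tensorA; congr tensor; exact: (bhom_ract f).
Qed.

Lemma bitens_mapE (m : M) n :
  bitens_map (tensor (m : rside M) n) = tensor (f m : rside M') (g n).
Proof. exact: tens_lift_tensor. Qed.

Lemma bitens_mapD : {morph bitens_map : s t / s + t}.
Proof. exact: tens_liftD. Qed.

Lemma bitens_map_linear : linear bitens_map.
Proof.
move=> a s t; rewrite bitens_mapD; congr (_ + _).
elim/tens_ind: s => [m n|s s' IHs IHs']; last first.
  by rewrite scalerDr !bitens_mapD scalerDr IHs IHs'.
rewrite -![_ *: _]/(bitens_lact _ _) bitens_lactE !bitens_mapE bitens_lactE.
by rewrite linearZ.
Qed.
HB.instance Definition _ := GRing.isLinear.Build A (bitens M N) (bitens M' N') _
  bitens_map bitens_map_linear.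

Lemma bitens_map_ract t c :
  bitens_map (ract (t : bitens M N) c) = ract (bitens_map t) c.
Proof.
elim/tens_ind: t => [m n|s s' IHs IHs']; last first.
  by rewrite ractDl !bitens_mapD ractDl IHs IHs'.
by rewrite ![ract _ c]bitens_ractE !bitens_mapE bhom_ract [RHS]bitens_ractE.
Qed.

Definition bitens_hom : bimod_hom (bitens M N) (bitens M' N') :=
  BimodHom bitens_map_ract.
End TensorMap.

Lemma retract_bitens (A B C : fdAlgType k) (M M' : bimodType A B)
    (N N' : bimodType B C) :
  retract M M' -> retract N N' -> retract (bitens M N) (bitens M' N').
Proof.
move=> [i [p ipK]] [j [q jqK]].
exists (bitens_hom i j), (bitens_hom p q).
apply: tens_ext => // [s t|m n]; first by rewrite /= !bitens_mapD.
by rewrite /= !bitens_mapE ipK jqK.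
Qed.
End Retracts.

(** * Separable equivalences of symmetric algebras *)

Theorem mainTheorem8 (k : fieldType) (A B : fdAlgType k) :
  symmetric_algebra A -> symmetric_algebra B ->
  (separably_equivalent A B <-> symmetrically_separably_equivalent A B).
Proof.
move=> symA symB; split=> [|[M [N [sepMN _ _]]]]; last by exists M, N.
move=> [M [N [M_fgp N_fgp [X /summand_retract A_MN] [Y /summand_retract B_NM]]]].
have [Ml_fg Ml_proj Mr_fg Mr_proj] := M_fgp.
have [Nl_fg Nl_proj Nr_fg Nr_proj] := N_fgp.
(* N is put second in N' so that the adjoint pairs M, M* and N*, N face each
   other. *)
pose M' : bimodType A B := (M * bdual N)%type.
pose N' : bimodType B A := (bdual M * N)%type.
have dualMN : dual_pair M' N'.
  by apply: dual_pair_dsum; [exact: dual_pair_bdualr | exact: dual_pair_bduall].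
have dualNM : dual_pair N' M'.
  by apply: dual_pair_dsum; [exact: dual_pair_bduall | exact: dual_pair_bdualr].
have rM : retract M M' := retract_dsuml _ _.
have rN : retract N N' := retract_dsumr _ _.
have [M'r_fg M'r_proj N'l_fg N'l_proj] := dual_pair_fgp dualMN.
have [N'r_fg N'r_proj M'l_fg M'l_proj] := dual_pair_fgp dualNM.
exists M', N'; split; [split | |]; rewrite ?/fg_projective_sides //.
- exact: retract_summand (retract_trans A_MN (retract_bitens rM rN)).
- exact: retract_summand (retract_trans B_NM (retract_bitens rN rM)).
- exact: dual_pair_left_adjoint dualMN.
- exact: dual_pair_left_adjoint dualNM.
Qed.
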